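(* Let $v$ be a valuation on a field $K$ with valuation ring $\mathcal{O}_v$, maximal ideal $\mathfrak{m}_v$, residue field $Kv=\mathcal{O}_v/\mathfrak{m}_v$ and value group $\Gamma_v$, and let $R\subseteq\mathcal{O}_v$ be a subring. If $\Gamma_v$ is a free (abelian) group or $Kv$ is closed by radicals, then there exists a choice function $\epsilon:v(R)\to R$ such that $\overline{\epsilon}(\gamma,\gamma')=1$ in $Kv$ for all $\gamma,\gamma'\in v(R)$.
   Context: For $x\in\mathcal{O}_v$, $xv$ denotes its residue in $Kv$. $v(R)\subseteq\Gamma_v$ denotes the image of $R\setminus\{0\}$ under $v$. A choice function on $v(R)$ is a map $\epsilon:v(R)\to R$ with $v(\epsilon(\gamma))=\gamma$ for all $\gamma\in v(R)$ and $\epsilon(0)=1$. Its twisting is the map $\overline{\epsilon}:v(R)\times v(R)\to Kv$ given by $\overline{\epsilon}(\gamma,\gamma')=\left(\frac{\epsilon(\gamma)\epsilon(\gamma')}{\epsilon(\gamma+\gamma')}\right)v$. $Kv$ is closed by radicals means: for every $c\in Kv$ and every integer $n\ge1$ there is $b\in Kv$ with $b^n=c$.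
   Formalization: The formal theorem additionally assumes that R maps onto the residue field Kv (every class in Kv is the residue of an element of R); without this the claim fails, e.g. for R = Q[t^2, 2^(1/3) t^3] in Q̄(t) with the t-adic valuation. *)

(* Defs.v *)
From HB Require Import structures.
From mathcomp Require Import all_boot all_order all_algebra.

Set Implicit Arguments.
Unset Strict Implicit.
Unset Printing Implicit Defensive.

Import Order.TTheory GRing.Theory Num.Theory.
Local Open Scope ring_scope.

(* Totality is a plain field: inheriting from
   Order.Total would need joins that the library hierarchy does not provide. *)
HB.mixin Record POrderedZmodule_isOrderedAbelianGroup G
    of Num.POrderedZmodule G := {
  oag_leD2l : forall z x y : G, x <= y -> z + x <= z + y;
  oag_total : forall x y : G, (x <= y) || (y <= x)
}.

#[short(type="oagType")]
HB.structure Definition OrderedAbelianGroup :=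
  {G of Num.POrderedZmodule G & POrderedZmodule_isOrderedAbelianGroup G}.

Section ExtendedGroup.
Variable G : oagType.

(* [option G] is G with a largest element infinity, encoded as [None]. *)
Definition ext_le (a b : option G) : bool :=
  match a, b with
  | _, None => true
  | None, Some _ => false
  | Some g, Some h => g <= h
  end.

Definition ext_min (a b : option G) : option G := if ext_le a b then a else b.

Definition ext_add (a b : option G) : option G :=
  match a, b with
  | Some g, Some h => Some (g + h)
  | _, _ => None
  end.

End ExtendedGroup.

(* Surjectivity makes G the value group of the valuation. *)
Record valuation (K : fieldType) (G : oagType) := Valuation {
  val_fun :> K -> option G;
  val_eq_infty : forall x, val_fun x = None <-> x = 0;
  val_mul : forall x y, val_fun (x * y) = ext_add (val_fun x) (val_fun y);
  val_add : forall x y,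
    ext_le (ext_min (val_fun x) (val_fun y)) (val_fun (x + y));
  val_surj : forall g, exists x, val_fun x = Some g
}.

Section ValuationRing.
Variables (K : fieldType) (G : oagType) (v : valuation K G).

Definition in_vring : pred K := fun x => ext_le (Some 0) (v x).

Lemma val_0 : v 0 = None.
Proof. exact/val_eq_infty. Qed.

Lemma val_neq0 x : x != 0 -> exists g, v x = Some g.
Proof.
move=> x0; case E: (v x) => [g|]; first by exists g.
by move/val_eq_infty: E x0 => ->; rewrite eqxx.
Qed.

Lemma val_1 : v 1 = Some 0.
Proof.
have [g vg] := val_neq0 (oner_neq0 K).
have := val_mul v 1 1; rewrite mulr1 vg /= => -[] /esym/eqP.
by rewrite -subr_eq0 addrK => /eqP ->.
Qed.

Lemma oag_double_eq0 (g : G) : g + g = 0 -> g = 0.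
Proof.
move=> gg; apply/eqP; rewrite eq_le; apply/andP.
have /orP[g0|g0] := oag_total g 0; split=> //.
- by have := oag_leD2l g g 0 g0; rewrite gg addr0.
- by have := oag_leD2l g 0 g g0; rewrite gg addr0.
Qed.

Lemma val_opp x : v (- x) = v x.
Proof.
have vN1 : v (- 1) = Some 0.
  have N10 : (-1 : K) != 0 by rewrite oppr_eq0 oner_neq0.
  have [g vg] := val_neq0 N10.
  have := val_mul v (-1) (-1); rewrite mulrNN mulr1 val_1 vg /= => -[].
  by move/esym/oag_double_eq0 => ->.
rewrite -mulN1r val_mul vN1; case: (v x) => //= g; by rewrite add0r.
Qed.

Lemma ext_le_add (a b c : option G) x y :
  a = v x -> b = v y -> ext_le c a -> ext_le c b -> ext_le c (v (x + y)).
Proof.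
move=> -> -> ca cb; have := val_add v x y; rewrite /ext_min.
have tr p q r : @ext_le G p q -> ext_le q r -> ext_le p r.
  by case: p q r => [p|] [q|] [r|] //=; apply: le_trans.
by case: ifP => _; apply: tr.
Qed.

Lemma in_vring_subring : subring_closed in_vring.
Proof.
split.
- by rewrite unfold_in /in_vring val_1 /=.
- move=> x y; rewrite !unfold_in /in_vring => vx vy.
  by apply: (ext_le_add erefl erefl) => //; rewrite val_opp.
- move=> x y; rewrite !unfold_in /in_vring val_mul.
  case: (v x) (v y) => [g|] [h|] //= g0 h0.
  by apply: le_trans g0 _; have := oag_leD2l g 0 h h0; rewrite addr0.
Qed.
HB.instance Definition _ := GRing.isSubringClosed.Build K in_vring in_vring_subring.

Record vring := VRing {
  vring_val :> K;
  _ : vring_val \in in_vring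
}.
HB.instance Definition _ := [isSub for vring_val].
HB.instance Definition _ := [Choice of vring by <:].
HB.instance Definition _ := [SubChoice_isSubComNzRing of vring by <:].

Definition vmax : pred vring := fun x =>
  if v (val x) is Some g then 0 < g else true.

Lemma vmaxE (x : vring) :
  (x \in vmax) = if v (val x) is Some g then 0 < g else true.
Proof. by rewrite unfold_in. Qed.

Lemma vmax_idealr : idealr_closed vmax.
Proof.
split.
- by rewrite vmaxE /= val_0.
- by rewrite vmaxE /= val_1 ltxx.
- move=> a x y xI yI.
  have axI : a * x \in vmax.
    move: xI; rewrite !vmaxE /= val_mul.
    have := valP a; rewrite unfold_in /in_vring.
    case: (v (val a)) (v (val x)) => [g|] [h|] //= g0 h0.
    by apply: lt_le_trans h0 _; have := oag_leD2l h 0 g g0; rewrite addr0 addrC.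
  move: axI yI; move: (a * x) => z; rewrite !vmaxE /=.
  have := val_add v (val z) (val y); rewrite /ext_min /=.
  case: (v (val z)) (v (val y)) (v (val z + val y)) => [g|] [h|] [k|] //=;
    try case: ifP => _; move=> *;
    by eapply lt_le_trans; [|eassumption]; assumption.
Qed.
HB.instance Definition _ := isIdealr.Build vring vmax vmax_idealr.

Definition vmax_ideal : idealr vring := Idealr.clone vring vmax _.
Definition residue_field := {ideal_quot vmax_ideal}.
HB.instance Definition _ := GRing.ComNzRing.on residue_field.
HB.instance Definition _ := EqQuotient.on residue_field.

(* The residue xv of x; only meaningful for x in O_v, and 0 elsewhere. *)
Definition residue (x : K) : residue_field :=
  \pi_residue_field%qT (insubd (0 : vring) x).

Definition residue_inv (c : residue_field) : residue_field :=
  if c == 0 then 0 else residue (val (repr c))^-1.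

Lemma residue_mulVf c : c != 0 -> residue_inv c * c = 1.
Proof.
rewrite /residue_inv => c0; rewrite (negPf c0) /residue.
move: c0; rewrite -{1 3}[c]reprK; set x := repr c => c0.
have vx : v (val x) = Some 0.
  have xN : x \notin vmax.
    apply: contra c0 => xI; rewrite -(rmorph0 (\pi_residue_field)%qT).
    by rewrite -Quotient.idealrBE subr0.
  have := valP x; move: xN; rewrite vmaxE unfold_in /in_vring.
  case: (v (val x)) => [g|] //= g0 Hg; congr Some; apply/eqP.
  by move: g0; rewrite lt_neqAle Hg andbT negbK eq_sym.
have x0 : val x != 0.
  by apply/eqP => /(val_eq_infty v); rewrite vx.
have vxV : v (val x)^-1 = Some 0.
  have xV0 : (val x)^-1 != 0 by rewrite invr_eq0.
  have [g vg] := val_neq0 xV0.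
  have := val_mul v (val x) (val x)^-1.
  by rewrite mulfV // val_1 vx vg /= add0r => ->.
rewrite -(rmorphM (\pi_residue_field)%qT) -(rmorph1 (\pi_residue_field)%qT).
congr (_ _); apply: val_inj; rewrite /= insubdK ?mulVf //.
have vxO : (val x)^-1 \in in_vring by rewrite unfold_in /in_vring vxV /=.
exact: vxO.
Qed.

Lemma residue_inv0 : residue_inv 0 = 0.
Proof. by rewrite /residue_inv eqxx. Qed.

HB.instance Definition _ := GRing.ComNzRing_isField.Build residue_field
  residue_mulVf residue_inv0.

Variable R : {pred K}.

Definition value_set (g : G) : Prop :=
  exists x, [/\ x \in R, x != 0 & v x = Some g].

(* A map v(R) -> R is represented by a function G -> K, of which only the
   values on v(R) matter. *)
Definition choice_function (eps : G -> K) : Prop :=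
  [/\ forall g, value_set g -> eps g \in R,
      forall g, value_set g -> v (eps g) = Some g
    & eps 0 = 1].

(* The composite R -> O_v -> Kv is onto, i.e. R / (R :&: m_v) = Kv. *)
Definition residually_full : Prop :=
  forall c : residue_field, exists2 x, x \in R & residue x = c.

Definition twisting (eps : G -> K) (g h : G) : residue_field :=
  residue (eps g * eps h / eps (g + h)).

End ValuationRing.

Arguments in_vring {K G} v.
Arguments residue_field {K G} v.

Section FreeAbelianGroup.
Variable G : zmodType.

Definition int_comb (s : seq G) (c : G -> int) : G := \sum_(b <- s) b *~ c b.

(* B is a basis of G as a module over the integers. *)
Definition is_basis (B : G -> Prop) : Prop :=
  (forall g, exists s c, (forall b, b \in s -> B b) /\ g = int_comb s c) /\
  (forall s c, uniq s -> (forall b, b \in s -> B b) -> int_comb s c = 0 ->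
     forall b, b \in s -> c b = 0).

Definition free_abelian_group : Prop := exists B, is_basis B.

End FreeAbelianGroup.

Definition closed_by_radicals (F : fieldType) : Prop :=
  forall (c : F) (n : nat), (1 <= n)%N -> exists b : F, b ^+ n = c.

(* Main.v *)
Require Import Defs.
From mathcomp Require Import all_boot all_order all_algebra.
From mathcomp Require Import ring boolp classical_sets.

(** Let U be the group of one-units of the valuation, the elements of residue 1.
Everything takes place in the extension of abelian groups
<<
  1 -> Kv^* -> K^* / U -> G -> 0.
>>
A choice function with trivial twisting is a section of this extension over
v(R) that is multiplicative and represented by elements of R.

A splitting e suffices (total_section_choice): if x in R has value g, then
x / e(g) is a unit of the valuation ring, and since R surjects onto the residue
field, x can be multiplied by an element of R of the inverse residue. The result
is in R, still has value g, and agrees with e(g) modulo U, so on v(R) it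
inherits the multiplicativity of e modulo U.

A splitting exists in both cases. If G is free, a basis can be lifted
arbitrarily (free_total_section). If Kv is closed by radicals, then Kv^* is
divisible, hence injective, and the proof is Baer's: by Zorn's lemma there is a
maximal partial splitting (radicals_total_section), and a partial splitting
extends to any further g (compatible_lift, adjoin_residual_section). If d is the
least positive integer such that d g is in the domain, with lift y, then any x0
of value g has to be corrected by a unit whose residue is a d-th root of the
residue of y / x0^d. *)

Set Implicit Arguments.
Unset Strict Implicit.
Unset Printing Implicit Defensive.

Import Order.TTheory GRing.Theory Num.Theory.
Local Open Scope ring_scope.

Lemma big_fibers (T : Type) (idx : T) (op : Monoid.com_law idx) (I : eqType)
    (J : eqType) (l : seq I) (f : I -> J) (F : I -> T) :
  \big[op/idx]_(i <- l) F i =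
  \big[op/idx]_(j <- undup [seq f i | i <- l]) \big[op/idx]_(i <- l | f i == j) F i.
Proof.
rewrite (exchange_big_dep predT) //=; apply: eq_big_seq => i il.
rewrite -big_filter (eq_filter (a2 := pred1 (f i))) => [|j]; last exact: eq_sym.
by rewrite filter_pred1_uniq ?undup_uniq ?mem_undup ?map_f // big_seq1.
Qed.

(** * Values and residues *)

Section ResidueMap.
Variables (K : fieldType) (G : oagType) (v : valuation K G).

Lemma val_Some_neq0 x g : v x = Some g -> x != 0.
Proof. by move=> vx; apply/eqP => x0; move: vx; rewrite x0 val_0. Qed.

Lemma val_mulS x y g h : v x = Some g -> v y = Some h -> v (x * y) = Some (g + h).
Proof. by rewrite val_mul => -> ->. Qed.

Lemma val_inv x g : v x = Some g -> v x^-1 = Some (- g).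
Proof.
move=> vx; have x0 := val_Some_neq0 vx.
have xV0 : x^-1 != 0 by rewrite invr_eq0.
have [h vh] := val_neq0 v xV0; have := val_mulS vx vh.
rewrite divff // val_1 vh => -[/esym/eqP].
by rewrite addrC addr_eq0 => /eqP ->.
Qed.

Lemma val_div x y g h : v x = Some g -> v y = Some h -> v (x / y) = Some (g - h).
Proof. by move=> vx vy; apply/val_mulS/val_inv. Qed.

Lemma val_exprz x g (n : int) : v x = Some g -> v (x ^ n) = Some (g *~ n).
Proof.
move=> vx; have vxn m : v (x ^+ m) = Some (g *+ m).
  elim: m => [|m IHm]; first by rewrite expr0 mulr0n val_1.
  by rewrite exprS mulrS (val_mulS vx IHm).
by case: n => n; [exact: vxn | apply/val_inv/vxn].
Qed.

Lemma val_Some0_vring x : v x = Some 0 -> x \in in_vring v.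
Proof. by move=> vx; rewrite unfold_in /in_vring vx /=. Qed.

Lemma residue_vring (x : vring v) : residue v (val x) = \pi_(residue_field v)%qT x.
Proof. by rewrite /residue valKd. Qed.

Lemma residue_out x : x \notin in_vring v -> residue v x = 0.
Proof. by move=> xN; rewrite /residue /insubd insubN //= rmorph0. Qed.

Lemma residueM x y : x \in in_vring v -> y \in in_vring v ->
  residue v (x * y) = residue v x * residue v y.
Proof.
move=> xO yO; rewrite -[x](SubK (vring v) xO) -[y](SubK (vring v) yO).
by rewrite -rmorphM !residue_vring rmorphM.
Qed.

Lemma residue1 : residue v 1 = 1.
Proof. by rewrite -(rmorph1 (val : vring v -> K)) residue_vring rmorph1. Qed.

Lemma residueV x : v x = Some 0 -> residue v x^-1 = (residue v x)^-1.
Proof.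
move=> vx; have vxV := val_inv vx; rewrite oppr0 in vxV.
have e : residue v x * residue v x^-1 = 1.
  by rewrite -residueM ?val_Some0_vring // divff ?residue1 // (val_Some_neq0 vx).
have r0 : residue v x != 0.
  by apply: contra_eq_neq e => ->; rewrite mul0r eq_sym oner_neq0.
by apply: (mulfI r0); rewrite e divff.
Qed.

Lemma residue_neq0 x : (residue v x != 0) = (v x == Some 0).
Proof.
apply/idP/eqP => [|vx]; last first.
  have vxV := val_inv vx; rewrite oppr0 in vxV.
  have e := residueM (val_Some0_vring vx) (val_Some0_vring vxV).
  rewrite divff ?(val_Some_neq0 vx) // residue1 in e.
  by apply: contra_eq_neq e => ->; rewrite mul0r oner_neq0.
case: (boolP (x \in in_vring v)) => [xO|/residue_out ->]; last by rewrite eqxx.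
rewrite -[x](SubK (vring v) xO); move: (Sub x xO : vring v) => u.
rewrite residue_vring => u0.
have uN : u \notin vmax (v := v).
  apply: contra u0 => uI; rewrite -(rmorph0 (\pi_(residue_field v))%qT).
  by rewrite -Quotient.idealrBE subr0.
have := valP u; move: uN; rewrite vmaxE unfold_in /in_vring.
case: (v (val u)) => [g|] //= g0 Hg; congr Some; apply/eqP.
by move: g0; rewrite lt_neqAle Hg andbT negbK eq_sym.
Qed.

Lemma residue_onto (c : residue_field v) : exists x, residue v x = c.
Proof. by exists (val (repr c)); rewrite residue_vring reprK. Qed.

(** Residues are 0 outside the valuation ring, so that residue 1 by itself
already says that x is in the ring and is a unit there. *)
Lemma one_unit_val x : residue v x = 1 -> v x = Some 0.
Proof. by move=> rx; apply/eqP; rewrite -residue_neq0 rx oner_neq0. Qed.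

Lemma one_unitM x y : residue v x = 1 -> residue v y = 1 -> residue v (x * y) = 1.
Proof.
move=> rx ry; have [vx vy] := (one_unit_val rx, one_unit_val ry).
by rewrite residueM ?val_Some0_vring // rx ry mulr1.
Qed.

Lemma one_unitV x : residue v x = 1 -> residue v x^-1 = 1.
Proof. by move=> rx; rewrite residueV ?rx ?invr1 ?(one_unit_val rx). Qed.

Lemma one_unit_exprz x (n : int) : residue v x = 1 -> residue v (x ^ n) = 1.
Proof.
move=> rx; have rxn m : residue v (x ^+ m) = 1.
  by elim: m => [|m IHm]; rewrite ?residue1 // exprS one_unitM.
by case: n => n; [exact: rxn | apply/one_unitV/rxn].
Qed.

Lemma residueX x n : v x = Some 0 -> residue v (x ^+ n) = residue v x ^+ n.
Proof.
move=> vx; have vxn m : v (x ^+ m) = Some 0.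
  by rewrite -(mul0rz G m) -(val_exprz m vx).
elim: n => [|n IHn]; first exact: residue1.
by rewrite !exprS residueM ?val_Some0_vring // IHn.
Qed.

End ResidueMap.

(** * Splittings of K^* modulo one-units *)

Section ResidualSections.
Variables (K : fieldType) (G : oagType) (v : valuation K G).

(** A homomorphism from a subgroup of G to K^* modulo one-units that is a section
of the valuation, encoded as a subgroup of lifts in the product of G and K^*. As a set of pairs it
can be fed to Zorn's lemma on unions of chains; well-definedness modulo one-units
reduces, by closure under division, to the lifts of 0. The empty set
qualifies, which covers the empty chain. *)
Definition residual_section (E : set (G * K)) : Prop :=
  [/\ forall g y, E (g, y) -> v y = Some g,
      forall g h y z, E (g, y) -> E (h, z) -> E (g - h, y / z)
    & forall y, E (0, y) -> residue v y = 1].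

Lemma residual_section0 (E : set (G * K)) p :
  residual_section E -> E p -> E (0, 1).
Proof.
case: p => g y [Ev Ediv _] Ep; have := Ediv _ _ _ _ Ep Ep.
by rewrite subrr divff // (val_Some_neq0 (Ev _ _ Ep)).
Qed.

Lemma residual_section_exprz (E : set (G * K)) g y (n : int) :
  residual_section E -> E (g, y) -> E (g *~ n, y ^ n).
Proof.
move=> sE Ep; have E1 := residual_section0 sE Ep; have [_ Ediv _] := sE.
have EV h z : E (h, z) -> E (- h, z^-1).
  by move=> Ehz; have := Ediv _ _ _ _ E1 Ehz; rewrite sub0r div1r.
have En m : E (g *+ m, y ^+ m).
  elim: m => [|m IHm] //; have := Ediv _ _ _ _ IHm (EV _ _ Ep).
  by rewrite opprK invrK exprSr mulrSr.
by case: n => n; [exact: En | apply/EV/En].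
Qed.

(** The lifts e(g) need not be in R; they are used only as a reference modulo
one-units, to which elements of R are then adjusted. *)
Lemma total_section_choice (R : subringClosed K) (E : set (G * K)) :
  residually_full v R -> residual_section E ->
  (forall g, exists y, E (g, y)) ->
  exists eps : G -> K, choice_function v R eps /\
    forall g h, value_set v R g -> value_set v R h -> twisting v eps g h = 1.
Proof.
move=> R_full sE /choice[e eE]; have [Ev Ediv E0] := sE.
have ve g := Ev _ _ (eE g).
have /choice[eps epsP] : forall g, exists x, value_set v R g ->
    [/\ x \in R, v x = Some g, residue v (x / e g) = 1 & g = 0 -> x = 1].
  move=> g.
  (* At g = 0 the value 1 is imposed; it agrees with the splitting because e(0) is
     a one-unit. *)
  have [->|g0] := eqVneq g 0.
    exists 1 => _; split; rewrite ?rpred1 ?val_1 // div1r.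
    by apply/one_unitV/E0/eE.
  have [[x [xR _ vx]]|nS] := pselect (value_set v R g); last by exists 0.
  have vxe := val_div vx (ve g); rewrite subrr in vxe.
  have [u uR ru] := R_full (residue v (x / e g))^-1.
  have r0 : residue v (x / e g) != 0 by rewrite residue_neq0 vxe.
  have vu : v u = Some 0 by apply/eqP; rewrite -residue_neq0 ru invr_eq0.
  exists (u * x) => _; split; first exact: rpredM.
  - by rewrite (val_mulS vu vx) add0r.
  - by rewrite -mulrA residueM ?val_Some0_vring // ru mulVf.
  - by move=> g00; rewrite g00 eqxx in g0.
have vs0 : value_set v R 0.
  by exists 1; rewrite rpred1 oner_neq0 val_1.
exists eps; split.
  split=> [g /epsP[]|g /epsP[]|] //.
  by have [_ _ _ ->] := epsP 0 vs0.
move=> g h Sg Sh; rewrite /twisting.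
have Sgh : value_set v R (g + h).
  have [[x [xR _ vx]] [y [yR _ vy]]] := (Sg, Sh).
  have vxy := val_mulS vx vy.
  by exists (x * y); rewrite rpredM // vxy (val_Some_neq0 vxy).
have [[[_ vg rg _] [_ vh rh _]] [_ vgh rgh _]] := (epsP _ Sg, epsP _ Sh, epsP _ Sgh).
have EM : residue v (e g * e h / e (g + h)) = 1.
  apply: E0; have EN := Ediv _ _ _ _ (residual_section0 sE (eE g)) (eE h).
  have := Ediv _ _ _ _ (Ediv _ _ _ _ (eE g) EN) (eE (g + h)).
  by rewrite sub0r opprK subrr div1r invrK.
have ne k := val_Some_neq0 (ve k).
(* The twisting of eps is that of e up to the factors eps / e, all one-units. *)
have -> : eps g * eps h / eps (g + h) = eps g / e g * (eps h / e h) *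
    (e g * e h / e (g + h) * (eps (g + h) / e (g + h))^-1).
  by field; rewrite !ne (val_Some_neq0 vgh).
exact: one_unitM (one_unitM rg rh) (one_unitM EM (one_unitV rgh)).
Qed.

Definition adjoin (A : set (G * K)) g x : set (G * K) :=
  [set p : G * K | exists h y (n : int), A (h, y) /\ p = (h + g *~ n, y * x ^ n)].

(** The only obstruction to sending g to x is on the multiples of g where a lift
has already been chosen: a relation h + n g = 0 says that n g is one of them. *)
Lemma adjoin_residual_section A g x :
  residual_section A -> v x = Some g ->
  (forall (n : int) y, A (g *~ n, y) -> residue v (x ^ n / y) = 1) ->
  residual_section (adjoin A g x).
Proof.
move=> sA vx compat; have [Av Adiv A0] := sA; have x0 := val_Some_neq0 vx.
split=> [_ _ [h [y [n [Ahy [-> ->]]]]]| |].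
- exact: val_mulS (Av _ _ Ahy) (val_exprz n vx).
- move=> _ _ _ _ [h [y [n [Ahy [-> ->]]]]] [k [z [m [Akz [-> ->]]]]].
  exists (h - k), (y / z), (n - m); split; first exact: Adiv.
  by rewrite mulrzBr opprD addrACA invfM mulrACA expfzDr // invr_expz.
- move=> _ [h [y [n [Ahy [/esym/eqP + ->]]]]]; rewrite addr_eq0 => /eqP hE.
  have := Adiv _ _ _ _ (residual_section0 sA Ahy) Ahy.
  rewrite hE sub0r opprK div1r => /compat; by rewrite invrK mulrC.
Qed.

(** This is where the divisibility of Kv^* is used: the multiples of g in the
domain are those of a single d g, so that compatibility there is enough. *)
Lemma compatible_lift A g p :
  closed_by_radicals (residue_field v) -> residual_section A -> A p ->
  exists2 x, v x = Some g &
    forall (n : int) y, A (g *~ n, y) -> residue v (x ^ n / y) = 1.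
Proof.
move=> rad sA Ap; have [Av Adiv A0] := sA.
have A1 := residual_section0 sA Ap.
have [x0 vx0] := val_surj v g.
pose P (n : nat) := (0 < n)%N && `[< exists y, A (g *+ n, y) >].
have PE n : (0 < n)%N -> (exists y, A (g *+ n, y)) -> P n.
  by move=> n0 ?; apply/andP; split=> //; apply/asboolP.
have [exP|nexP] := pselect (exists n, P n); last first.
  (* Without positive multiples of g in the domain, only n = 0 has to be checked. *)
  exists x0 => // n y Any.
  suff n0 : n = 0.
    by move: Any; rewrite n0 mulr0z expr0z div1r => /A0/one_unitV.
  case: n Any => [[|n]|n] // Any; exfalso; apply: nexP; exists n.+1.
    by apply: PE => //; exists y.
  apply: PE => //; exists y^-1.
  by have := Adiv _ _ _ _ A1 Any; rewrite sub0r NegzE mulrNz opprK div1r.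
case: (ex_minnP exP) => d /andP[d0 /asboolP[y Ady]] dmin.
have vyx0 : v (y / x0 ^+ d) = Some 0.
  by rewrite (val_div (Av _ _ Ady) (val_exprz d vx0)) subrr.
have [b bd] := rad (residue v (y / x0 ^+ d)) d d0.
have [u ru] := residue_onto b.
have vu : v u = Some 0.
  apply/eqP; rewrite -residue_neq0 ru; apply/eqP => b0.
  move: bd; rewrite b0 expr0n -(prednK d0) /= => /esym/eqP; apply/negP.
  by rewrite residue_neq0 -vyx0 prednK.
(* By the choice of b, u^d has the residue of y / x0^d. *)
have rxd : residue v ((x0 * u) ^+ d / y) = 1.
  have yn0 := val_Some_neq0 (Av _ _ Ady).
  have xn0 : x0 ^+ d != 0 by rewrite expf_neq0 // (val_Some_neq0 vx0).
  have -> : (x0 * u) ^+ d / y = u ^+ d / (y / x0 ^+ d).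
    by rewrite exprMn invf_div mulrCA mulrA.
  have vud : v (u ^+ d) = Some 0 by rewrite (val_exprz d vu) mul0rz.
  rewrite residueM ?residueV ?residueX // ?ru ?bd ?val_Some0_vring //.
    by rewrite divff // residue_neq0 vyx0.
  by rewrite (val_inv vyx0) oppr0.
exists (x0 * u); first by rewrite (val_mulS vx0 vu) addr0.
move=> n z Anz; set x := x0 * u in rxd *.
have dz0 : d%:Z != 0 by rewrite eqz_nat -lt0n.
have Aq := residual_section_exprz (n %/ d)%Z sA Ady.
have nE : n = (d%:Z * (n %/ d)%Z + (n %% d)%Z) by rewrite mulrC -divz_eq.
have : A (g *~ (n %% d)%Z, z / y ^ (n %/ d)%Z).
  have := Adiv _ _ _ _ Anz Aq.
  by rewrite {1}nE mulrzDr pmulrn mulrzA addrC addKr.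
have := modz_ge0 n dz0; have : (n %% d)%Z < d by rewrite ltz_pmod.
case E: (n %% d)%Z => [r|//] rd _ Ar.
(* r g is in the domain and r < d, so r = 0 by minimality of d. *)
have r0 : r = 0%N.
  apply/eqP; apply: contraLR (rd) => r0; rewrite -leNgt; apply: dmin.
  by apply: PE; [rewrite lt0n | exists (z / y ^ (n %/ d)%Z)].
have ny k : y ^ k != 0 by rewrite expfz_neq0 // (val_Some_neq0 (Av _ _ Ady)).
have nz := val_Some_neq0 (Av _ _ Anz).
have -> : x ^ n / z = (x ^+ d / y) ^ (n %/ d)%Z * (z / y ^ (n %/ d)%Z)^-1.
  rewrite expfzMl exprz_inv -invr_expz (exprnP x d) exprz_exp invf_div.
  rewrite [in LHS]nE E r0 addr0.
  by field; rewrite ny nz.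
move: Ar; rewrite r0 mulr0z => /A0/one_unitV.
exact: one_unitM (one_unit_exprz _ rxd).
Qed.

(** A maximal partial splitting is total, for otherwise it could be extended by
one more element. *)
Lemma radicals_total_section : closed_by_radicals (residue_field v) ->
  exists E, residual_section E /\ forall g, exists y, E (g, y).
Proof.
move=> rad.
have [F FP Ftot|E [sE Emax]] := @Zorn_bigcup _ residual_section.
  split.
  - by move=> g y [X FX /(let: And3 Xv _ _ := FP _ FX in Xv _ _)].
  - move=> g h y z [X FX Xg] [Y FY Yh].
    have [sXY|sYX] := Ftot _ _ FX FY.
    + by exists Y => //; have [_ Ydiv _] := FP _ FY; apply: Ydiv => //; apply: sXY.
    + by exists X => //; have [_ Xdiv _] := FP _ FX; apply: Xdiv => //; apply: sYX.
  - by move=> y [X FX]; have [_ _ X0] := FP _ FX; apply: X0.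
(* If E were empty, the trivial splitting on the zero subgroup would be larger. *)
have [p Ep] : exists p, E p.
  apply: contrapT => nE; refine (Emax [set (0, 1)]%classic _ _).
    split=> [p Ep|sub]; first by case: nE; exists p.
    by apply: nE; exists (0, 1); apply: sub.
  split=> [_ _ [-> ->]|_ _ _ _ [-> ->] [-> ->]|_ [->]]; rewrite ?val_1 ?residue1 //.
  by rewrite subr0 divr1.
exists E; split=> // g; have [x vx compat] := compatible_lift g rad sE Ep.
apply: contrapT => nEg; refine (Emax (adjoin E g x) _ _); last first.
  exact: adjoin_residual_section.
split=> [[h y] Ehy|sub].
  by exists h, y, 0; rewrite mulr0z addr0 expr0z mulr1.
apply: nEg; exists x; apply: sub.
exists 0, 1, 1; rewrite mulr1z add0r expr1z mul1r.
by split=> //; apply: residual_section0 Ep.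
Qed.

(** The lifts of g are the products obtained from all its expressions in terms of
the basis, as lists of pairs (basis element, coefficient) with repetitions
allowed, so that closure under division is concatenation. Independence is then
needed only for 0, where it makes the product exactly 1. *)
Lemma free_total_section : free_abelian_group G ->
  exists E, residual_section E /\ forall g, exists y, E (g, y).
Proof.
move=> [B [Bspan Bfree]].
have [x vx] := choice (val_surj v).
have x0 g : x g != 0 := val_Some_neq0 (vx g).
exists [set p : G * K | exists l : seq (G * int), (forall q, q \in l -> B q.1) /\
  p = (\sum_(q <- l) q.1 *~ q.2, \prod_(q <- l) x q.1 ^ q.2)]%classic.
split; last first.
  move=> g; have [s [c [sB ->]]] := Bspan g.
  exists (\prod_(b <- s) x b ^ c b), [seq (b, c b) | b <- s].
  split; last by rewrite !big_map.
  by move=> _ /mapP[b bs ->]; apply: sB.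
split.
- move=> _ _ [l [_ [-> ->]]].
  elim: l => [|q l IHl]; first by rewrite !big_nil val_1.
  by rewrite !big_cons (val_mulS (val_exprz q.2 (vx q.1)) IHl).
- move=> _ _ _ _ [l [lB [-> ->]]] [m [mB [-> ->]]].
  exists (l ++ [seq (q.1, - q.2) | q <- m]); split.
    by move=> q; rewrite mem_cat => /orP[/lB //|/mapP[r /mB rB ->]].
  rewrite !big_cat !big_map /= -sumrN -prodfV; congr (_ + _, _ * _).
    by apply: eq_bigr => q _; rewrite mulrNz.
  by apply: eq_bigr => q _; rewrite invr_expz.
- move=> _ [l [lB [/esym l0 ->]]].
  (* Collecting the repeated basis elements gives a reduced relation c. *)
  pose s := undup [seq q.1 | q <- l].
  pose c b := \sum_(q <- l | q.1 == b) q.2.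
  have sB b : b \in s -> B b.
    by rewrite mem_undup => /mapP[q /lB qB ->].
  have s0 : int_comb s c = 0.
    rewrite -l0 (big_fibers _ l fst); apply: eq_bigr => b _.
    rewrite /c (big_morph (intmul b) (mulrzDr b) (mulr0z b)).
    by apply: eq_bigr => q /eqP ->.
  have c0 := Bfree s c (undup_uniq _) sB s0.
  rewrite (big_fibers _ l fst) big1_seq ?residue1 // => b /= bs.
  have -> : \prod_(q <- l | q.1 == b) x q.1 ^ q.2 = x b ^ c b.
    rewrite /c (big_morph (exprz (x b)) (fun m n => expfzDr m n (x0 b)) (expr0z _)).
    by apply: eq_bigr => q /eqP ->.
  by rewrite (c0 _ bs) expr0z.
Qed.

End ResidualSections.

Theorem theorem1p2 (K : fieldType) (G : oagType) (v : valuation K G)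
    (R : subringClosed K) (R_sub : {subset R <= in_vring v})
    (R_full : residually_full v R) :
  free_abelian_group G \/ closed_by_radicals (residue_field v) ->
  exists eps : G -> K,
    choice_function v R eps /\
    (forall g h : G, value_set v R g -> value_set v R h ->
       twisting v eps g h = 1%R).
Proof.
move=> hyp.
have [E [sE Etot]] : exists E, residual_section v E /\ forall g, exists y, E (g, y).
  by case: hyp; [exact: free_total_section | exact: radicals_total_section].
exact: total_section_choice R_full sE Etot.
Qed.
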